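(* Let $G$ be a finite solvable group, let $p$ be a prime and let $P$ be a Sylow $p$-subgroup of $G$. If $|\mathrm{Vo}_{p}(G)|=1$, then the derived subgroup $P'$ of $P$ is subnormal in $G$. In particular, $P/\mathbf{O}_{p}(G)$ is cyclic.
   Context: For a finite group $G$, $\mathrm{Irr}(G)$ is the set of complex irreducible characters of $G$. An element $g\in G$ is a vanishing element of $G$ if $\chi(g)=0$ for some $\chi\in\mathrm{Irr}(G)$. $\mathrm{Vo}(G)$ denotes the set of orders of the vanishing elements of $G$, and $\mathrm{Vo}_{p}(G)$ denotes the subset of $\mathrm{Vo}(G)$ consisting of those orders divisible by the prime $p$. $\mathbf{O}_{p}(G)$ is the largest normal $p$-subgroup of $G$. *)

(* Defs.v *)
From mathcomp Require Import all_boot all_order all_fingroup all_algebra.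
From mathcomp Require Import all_solvable all_field all_character.

Set Implicit Arguments.
Unset Strict Implicit.
Unset Printing Implicit Defensive.

Import GroupScope GRing.Theory.

(* Class functions on G are extended by 0 outside G, hence the explicit
   restriction to g in G.  The characters in irr G take values in algC, which
   contains all values of complex characters of finite groups. *)
Definition vanishing (gT : finGroupType) (G : {group gT}) : {set gT} :=
  [set g in G | [exists i : Iirr G, ('chi_i g == 0)%R]].

(* Sets of orders are represented by duplicate-free sequences, so that their
   cardinality is their size. *)
Definition Vo (gT : finGroupType) (G : {group gT}) : seq nat :=
  undup [seq #[g] | g in vanishing G].

Definition Vo_at (p : nat) (gT : finGroupType) (G : {group gT}) : seq nat :=
  [seq n <- Vo G | p %| n].

Lemma vanishingP (gT : finGroupType) (G : {group gT}) (g : gT) :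
  reflect (g \in G /\ exists i : Iirr G, ('chi_i g = 0)%R) (g \in vanishing G).
Proof.
rewrite inE; apply: (iffP andP) => [[Gg /existsP[i /eqP chi0]]|[Gg [i chi0]]].
  by split=> //; exists i.
by split=> //; apply/existsP; exists i; rewrite chi0.
Qed.

Lemma VoP (gT : finGroupType) (G : {group gT}) (n : nat) :
  reflect (exists2 g, g \in vanishing G & n = #[g]) (n \in Vo G).
Proof. by rewrite mem_undup; apply: imageP. Qed.

Lemma Vo_at_uniq (p : nat) (gT : finGroupType) (G : {group gT}) :
  uniq (Vo_at p G).
Proof. by rewrite filter_uniq // undup_uniq. Qed.

(* Main.v *)
(* Put H = G / O_p(G).  Every p-singular element of H vanishes.  Since vanishing
   elements lift to vanishing elements, all p-singular elements of H are then
   p-elements, and a p-element x <> 1 of H has x ^+ p = 1, for otherwise lifts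
   of x and of x ^+ p would be vanishing elements of G of distinct orders.
   Hence P / O_p(G) has exponent p and acts semiregularly on a minimal normal
   subgroup of H, which forces its order to divide p.

   That p-singular elements vanish when O_p(G) = 1 is proved by induction on
   |G|.  Let V be a minimal normal subgroup and Q = O_p(G / V).  If
   L / V <= Q is abelian and normal, then some linear character of V is
   stabilised by no element of L outside V, so all elements of G with a power
   in L outside V vanish.  With L / V = Z(Q), semiregularity gives
   |Z(Q)| = p.  Elements of Z_2(Q) outside Z(Q) also vanish, because a
   nontrivial commutator with them generates Z(Q), so |Z_2(Q)| = p as well and
   Q is abelian.  Now take L / V = Q for the elements whose p-part lies in L,
   and induction in (G / V) / Q for the others. *)
Require Import Defs.
From mathcomp Require Import all_boot all_order all_fingroup all_algebra.
From mathcomp Require Import all_solvable all_field all_character.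

Set Implicit Arguments.
Unset Strict Implicit.
Unset Printing Implicit Defensive.

Import GroupScope.
Local Open Scope ring_scope.
Local Open Scope group_scope.

(** * Coprime action on abelian groups and their characters *)

Section CoprimeAbelian.

Variables (gT : finGroupType) (V A : {group gT}).
Hypotheses (nVA : A \subset 'N(V)) (abV : abelian V).

Lemma coprime_abel_cent_dprod :
  coprime #|V| #|A| -> [~: V, A] \x 'C_V(A) = V.
Proof.
move=> coVA; have nsRV: [~: V, A] <| V.
  by rewrite /normal commg_subl nVA commg_norml.
have [sRV nRV] := andP nsRV.
have cRC: 'C_V(A) \subset 'C([~: V, A]).
  by rewrite (subset_trans (subsetIl _ _)) // (sub_abelian_cent abV).
rewrite dprodE //; last by rewrite /= setIA (setIidPl sRV) coprime_abel_cent_TI.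
have nRA: A \subset 'N([~: V, A]) by rewrite commg_normr.
apply/eqP; rewrite eqEsubset mul_subG ?subsetIl //=.
rewrite -quotientSK // coprime_quotient_cent ?abelian_sol //=.
by rewrite subsetI subxx quotient_cents2 /=.
Qed.

(** ['chi_i] is linear and agrees at [v] and [v ^ c], so it is 1 on each generator of
    [[~: V, C]]. *)
Lemma abel_comm_sub_cfker_inertia (i : Iirr V) (C : {set gT}) :
  C \subset 'I['chi_i]%CF -> [~: V, C] \subset cfker 'chi_i.
Proof.
move=> sCI; have nVC := subset_trans sCI (norm_inertia _).
have lin_i: 'chi_i \is a linear_char by apply/char_abelianP.
rewrite gen_subG; apply/subsetP=> _ /imset2P[v c Vv Cc ->].
have Vvc: v ^ c \in V by rewrite memJ_norm ?(subsetP nVC).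
rewrite /= cfkerEirr inE commgEl lin_char1 //; apply/eqP.
rewrite lin_charM ?groupV // lin_charV // (inertia_valJ _ (subsetP sCI c Cc)).
by rewrite GRing.mulVf ?lin_char_neq0.
Qed.

End CoprimeAbelian.

Lemma abel_regular_irr (gT : finGroupType) (V A : {group gT}) :
    A \subset 'N(V) -> abelian V -> abelian A -> coprime #|V| #|A| ->
    'C_A(V) = 1 ->
  exists i : Iirr V, 'I_A['chi_i]%CF = 1.
Proof.
move=> nVA abV abA coVA regA.
(* If C, the stabiliser of 'chi_i, is nontrivial, replacing the (trivial)
   [~: V, C]-component of 'chi_i by a nontrivial one yields a smaller
   stabiliser. *)
have [i _ min_i] :=
  @arg_minnP (Iirr V) 0%R xpredT (fun i => #|'I_A['chi_i]%CF|) isT.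
exists i; apply/eqP/negPn/negP => ntC.
set C := ('I_A['chi_i]%G)%CF; have sCA: C \subset A := Inertia_sub _ _.
have nVC := subset_trans sCA nVA; have coVC := coprimegS sCA coVA.
have defV := coprime_abel_cent_dprod nVC abV coVC.
set K := [~: V, C]%G in defV; set D := ('C_V(C))%G in defV.
have nCA: A \subset 'N(C) by rewrite sub_abelian_norm.
have nKA: A \subset 'N(K) by rewrite normsR.
have nDA: A \subset 'N(D) by rewrite normsI ?norms_cent.
have sKV: K \subset V by rewrite commg_subl.
have defK: [~: K, C] = K.
  have abK := abelianS sKV abV; have nKC := subset_trans sCA nKA.
  have:= coprime_abel_cent_dprod nKC abK (coprimeSg sKV coVC).
  by rewrite /= coprime_abel_cent_TI // dprodg1.
(* Characters of [V] are pairs of characters of [K] and [D]. As [A] normalises both factors,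
   stabilisers in [A] are intersections of those of the components. *)
pose jk := inv_dprod_Iirr defV i.
have inertiaE l :
  'I_A['chi_(dprod_Iirr defV (l, jk.2))]%CF
    = 'I_A['chi_l]%CF :&: 'I_A['chi_jk.2]%CF.
  by rewrite dprod_IirrE inertia_dprod_irr.
have def_C: C = ('I_A['chi_jk.1] :&: 'I_A['chi_jk.2])%CF :> {set gT}.
  by rewrite -inertiaE -surjective_pairing inv_dprod_IirrK.
(* A character of [K] fixed by [C] has [[~: K, C] = K] in its kernel. *)
have fixed0 l : C \subset 'I['chi[K]_l]%CF -> l = 0%R.
  move/(abel_comm_sub_cfker_inertia (abelianS sKV abV)).
  by rewrite defK subGcfker => /eqP.
have ntK: K :!=: 1.
  apply: contra ntC; rewrite /= -/C => /eqP/commG1P cVC.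
  by rewrite -subG1 -regA subsetI sCA centsC.
have [l nz_l] := has_nonprincipal_irr ntK.
have:= min_i (dprod_Iirr defV (l, jk.2)) isT.
rewrite leqNgt => /negP[]; apply: proper_card.
rewrite inertiaE (_ : 'I_A['chi_i] = C) // properEneq; apply/andP; split.
  apply/eqP=> eqC; case/eqP: nz_l; apply: fixed0.
  by rewrite -eqC (subset_trans (subsetIl _ _)) ?subsetIr.
have j0: jk.1 = 0.
  apply/fixed0/(subset_trans _ (subsetIr A _)).
  by apply: subset_trans (subsetIl _ 'I_A['chi_jk.2]); rewrite -def_C.
suff: 'I_A['chi_l] :&: 'I_A['chi_jk.2]
        \subset 'I_A['chi_jk.1] :&: 'I_A['chi_jk.2].
  by rewrite -def_C.
by rewrite j0 inertia_irr0 (setIidPl nKA) setSI ?subsetIl.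
Qed.

(** * Sources of vanishing elements *)

Lemma quotient_vanishing (gT : finGroupType) (G N : {group gT}) (x : gT) :
    N <| G -> x \in G -> coset N x \in vanishing (G / N) ->
  x \in vanishing G.
Proof.
move=> nsNG Gx /vanishingP[_ [i chi_x0]]; apply/vanishingP; split=> //.
by exists (mod_Iirr i); rewrite mod_IirrE // cfModE.
Qed.

(** By Clifford correspondence, a constituent over [t] induces irreducibly from the inertia group;
    its value at [x] is a sum over conjugates of [x], all outside that group. *)
Lemma vanishing_inertia (gT : finGroupType) (G N : {group gT}) (t : Iirr N)
    (x : gT) :
    N <| G -> x \in G -> {in G, forall y, x ^ y \notin 'I['chi_t]} ->
  x \in vanishing G.
Proof.
move=> nsNG Gx notIx; apply/vanishingP; split=> //.
have [s Is] := constt_cfInd_irr t (sub_Inertia 'chi_t (normal_sub nsNG)).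
have [/(_ s Is) irr_s _ _ _ _] := constt_Inertia_bijection t nsNG.
exists (cfIirr ('Ind[G] 'chi_s)); rewrite cfIirrE // cfIndE ?Inertia_sub //.
rewrite big1 ?GRing.mulr0 // => y Gy; rewrite cfun0 //.
by apply: contra (notIx y Gy) => /setIP[].
Qed.

Lemma irr_mul_center (gT : finGroupType) (G : {group gT}) (i : Iirr G)
    (z : gT) :
    z \in 'Z(G) ->
  exists a : algC, {in G, forall x, 'chi_i (x * z) = (a * 'chi_i x)%R}.
Proof.
move=> Zz; have Gz: z \in G by case/setIP: Zz.
have: z \in 'Z('chi_i)%CF.
  by have:= Zz; rewrite -cap_cfcenter_irr => /bigcapP->.
rewrite -irrRepr cfcenter_repr => /setIdP[_ /is_scalar_mxP[a def_a]].
exists a => x Gx; rewrite !cfunE groupM // Gx !GRing.mulr1n.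
by rewrite repr_mxM // def_a mul_mx_scalar mxtraceZ.
Qed.

(** As [x ^ y = x * [~ x, y]], an irreducible character of [M] on which this central commutator acts
    by a scalar other than 1 is zero at [x]. A character of [G] nontrivial on ['Z(M)] restricts to a
    sum of such characters. *)
Lemma vanishing_center_comm (gT : finGroupType) (G M : {group gT}) (x y : gT) :
    M <| G -> prime #|'Z(M)| -> x \in M -> y \in M ->
    [~ x, y] \in 'Z(M) -> [~ x, y] != 1 ->
  x \in vanishing G.
Proof.
move=> nsMG prZ Mx My Zc ntc; have sMG := normal_sub nsMG.
have nsZG : 'Z(M) <| G := char_normal_trans (center_char M) nsMG.
have [i kerNi]: exists i : Iirr G, ~~ ('Z(M) \subset cfker 'chi_i).
  apply/existsP; rewrite -negb_forall; apply: contra ntc => /forallP kerZ.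
  rewrite -in_set1 -set1gE -(TI_cfker_irr G); apply/bigcapP=> i _.
  exact: subsetP (kerZ i) _ Zc.
apply/vanishingP; split; first exact: subsetP Mx.
exists i; rewrite -(cfResE _ sMG Mx) ['Res _]cfun_sum_constt sum_cfunE.
rewrite big1 // => j ij; rewrite cfunE.
have [a chi_xz] := irr_mul_center j Zc.
have:= chi_xz x Mx; rewrite -conjg_mulR cfunJ //.
case: (eqVneq a 1%R) => [a1 _ | ne_a1 /eqP]; last first.
  rewrite -GRing.subr_eq0 -{1}['chi_j x]GRing.mul1r -GRing.mulrBl.
  rewrite GRing.mulf_eq0 GRing.subr_eq0 eq_sym (negPf ne_a1) /= => /eqP->.
  by rewrite GRing.mulr0.
(* If [a = 1], the kernel of ['chi_j] meets ['Z(M)] nontrivially, so contains it by primality;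
   normality of ['Z(M)] in [G] carries this over to ['chi_i]. *)
case/negP: kerNi; apply: constt0_Res_cfker => //.
have sZj: 'Z(M) \subset cfker 'chi_j.
  apply: prime_meetG prZ _; apply/trivgPn; exists [~ x, y] => //.
  rewrite inE Zc /= cfkerEirr inE -[[~ x, y]]mul1g chi_xz ?group1 //.
  by rewrite a1 GRing.mul1r.
rewrite -(cfResRes _ (center_sub M) sMG).
apply: constt_Res_trans ij _ _; first by rewrite cfRes_char ?irr_char.
rewrite irr_consttE cfRes_sub_ker // -irr0 cfdotZl cfnorm_irr GRing.mulr1.
exact: irr1_neq0.
Qed.

(** * Tameness and its passage to quotients *)

Definition pvanishing (p : nat) (gT : finGroupType) (G : {group gT}) :=
  [set x in vanishing G | (p %| #[x])%N].

(* A consequence of |Vo_p(G)| = 1 which, unlike the latter, passes to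
   quotients. *)
Definition tame_pvanishing (p : nat) (gT : finGroupType) (G : {group gT}) :=
  {in pvanishing p G &, forall x y, p.-elt x -> p.-elt y /\ y != x ^+ p}.

Lemma Vo_at_tame (p : nat) (gT : finGroupType) (G : {group gT}) :
  prime p -> size (Vo_at p G) = 1%N -> tame_pvanishing p G.
Proof.
move=> pr_p Vo1 x y; rewrite !inE => /andP[van_x p_x] /andP[van_y p_y] px.
have{van_x} Vx: #[x] \in Vo_at p G.
  by rewrite mem_filter p_x; apply/VoP; exists x; rewrite ?inE.
have{van_y} Vy: #[y] \in Vo_at p G.
  by rewrite mem_filter p_y; apply/VoP; exists y; rewrite ?inE.
have oyx: #[y] = #[x].
  case: (Vo_at p G) Vo1 Vx Vy => [|n []] //= _.
  by rewrite !inE => /eqP-> /eqP->.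
split; first by rewrite /p_elt oyx.
apply/eqP=> y_xp; have:= ltn_Pdiv (prime_gt1 pr_p) (order_gt0 x).
by rewrite -{2}oyx y_xp orderXdiv // ltnn.
Qed.

Lemma quotient_tame (p : nat) (gT : finGroupType) (G N : {group gT}) :
  N <| G -> tame_pvanishing p G -> tame_pvanishing p (G / N).
Proof.
move=> nsNG tameG; have [_ nNG] := andP nsNG.
have lift (x : gT) :
  x \in G -> coset N x \in pvanishing p (G / N) -> x \in pvanishing p G.
  move=> Gx; rewrite inE [_ \in pvanishing p G]inE => /andP[van_x p_x].
  rewrite (quotient_vanishing nsNG) // (dvdn_trans p_x) ?morph_order //.
  exact: subsetP Gx.
move=> xb yb Vx Vy; have [Gxb Gyb]: xb \in G / N /\ yb \in G / N.
  by move: Vx Vy; rewrite !inE -!andbA => /andP[-> _] /andP[-> _].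
have [x0 _ Gx0 def_x] := morphimP Gxb; have [y nNy Gy def_y] := morphimP Gyb.
(* A lift of a [p]-element need not be a [p]-element, but its [p]-part is one and has the same
   image. *)
move=> px; have def_x': xb = coset N x0.`_p.
  by rewrite morph_constt ?(subsetP nNG) // -def_x constt_p_elt.
have Gx: x0.`_p \in G by rewrite groupX.
rewrite def_x' in Vx; rewrite def_y in Vy.
have tame_x := tameG _ _ (lift _ Gx Vx) _ (p_elt_constt p x0).
split; first by rewrite def_y morph_p_elt //; case: (tame_x y (lift _ Gy Vy)).
apply/eqP=> def_yx; have: x0.`_p ^+ p \in pvanishing p G.
  apply: lift; first exact: groupX.
  rewrite morphX ?(subsetP nNG) //; move: Vy.
  by rewrite -def_y def_yx {1}def_x'.
by case/tame_x=> _; rewrite eqxx.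
Qed.

(** * Semiregular actions forced by tameness *)

Lemma abelian_semiregular_cyclic (gT : finGroupType) (r : nat)
    (V A : {group gT}) :
    r.-abelem V -> V :!=: 1 -> A \subset 'N(V) -> abelian A ->
    semiregular V A ->
  cyclic A.
Proof.
move=> abelV ntV nVA abA regA.
(* A minimal [A]-invariant [W] is an irreducible module, faithful by semiregularity. *)
have [W minW sWV] := minnormal_exists ntV nVA.
have abelW := abelemS sWV abelV; have [/andP[ntW nWA] _] := mingroupP minW.
have irrW := elimT (abelem_mx_irrP abelW ntW nWA) minW.
apply: mx_faithful_irr_abelian_cyclic irrW abA.
rewrite /mx_faithful rker_abelem; apply/subsetP=> a /setIP[Aa cWa].
apply: contraR ntW; rewrite inE => nta; rewrite -subG1 -(regA a) ?inE ?nta //.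
by rewrite subsetI sWV sub_cent1.
Qed.

Lemma dvdn_order_constt (p : nat) (gT : finGroupType) (x : gT) :
  x.`_p != 1 -> (p %| #[x])%N.
Proof.
move=> ntx; rewrite -[X in (X %| _)%N](pdiv_p_elt (p_elt_constt p x) ntx).
by rewrite (dvdn_trans (pdiv_dvd _)) // order_constt dvdn_part.
Qed.

Lemma constt_mul_p'elt (p : nat) (gT : finGroupType) (s v : gT) :
  p.-elt s -> p^'.-elt v -> commute s v -> (s * v).`_p = s.
Proof.
by move=> ps p'v csv; rewrite consttM // (constt_p_elt ps) (constt1P p'v) mulg1.
Qed.

Section TameAction.

Variables (p r : nat) (gT : finGroupType) (G V S : {group gT}).
Hypotheses (pr_p : prime p) (tameG : tame_pvanishing p G).
Hypotheses (abelV : r.-abelem V) (ntV : V :!=: 1) (p'V : p^'.-group V).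
Hypotheses (sSG : S \subset G) (pS : p.-group S) (nVS : S \subset 'N(V)).
Hypothesis vanS :
  {in S^#, forall s, {in 'C_V[s], forall v, s * v \in vanishing G}}.

Let pvanS s : s \in S^# -> s \in pvanishing p G.
Proof.
move=> Ss; have:= vanS Ss (group1 _); rewrite mulg1 => van_s; rewrite inE van_s.
have /setD1P[nts Ss1] := Ss.
by rewrite dvdn_order_constt // constt_p_elt ?(mem_p_elt pS).
Qed.

(** If [v] in [V] commutes with [s], tameness makes [s * v] a [p]-element, hence equal to its
    [p]-part [s]. *)
Lemma tame_action_semiregular : semiregular V S.
Proof.
move=> s Ss; have /setD1P[nts Ss1] := Ss.
apply/trivgP/subsetP=> v Cv; have /setIP[Vv /cent1P csv] := Cv.
have ps := mem_p_elt pS Ss1; have p'v := mem_p_elt p'V Vv.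
have def_s: (s * v).`_p = s by rewrite constt_mul_p'elt.
have Vsv: s * v \in pvanishing p G.
  by rewrite inE vanS ?dvdn_order_constt ?def_s.
have [psv _] := tameG (pvanS Ss) Vsv ps.
by rewrite inE -(inj_eq (mulgI s)) mulg1 -{2}def_s constt_p_elt.
Qed.

Lemma tame_action_exponent : {in S, forall s, s ^+ p = 1}.
Proof.
move=> s Ss; apply/eqP/negPn/negP=> nt_sp.
have nts: s != 1 by apply: contraNneq nt_sp => ->; rewrite expg1n.
have Vs: s \in pvanishing p G by rewrite pvanS // !inE nts.
have Vsp: s ^+ p \in pvanishing p G by rewrite pvanS // !inE nt_sp groupX.
by have [_ /eqP[]] := tameG Vs Vsp (mem_p_elt pS Ss).
Qed.

Lemma tame_action_prime_abelian (A : {group gT}) :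
  A \subset S -> abelian A -> A :!=: 1 -> #|A| = p.
Proof.
move=> sAS abA ntA; have nVA := subset_trans sAS nVS.
have: cyclic A.
  apply: abelian_semiregular_cyclic abelV ntV nVA abA _.
  exact: semiregularS tame_action_semiregular.
case/cyclicP=> a defA; rewrite defA -orderE; apply: nt_prime_order => //.
  by rewrite tame_action_exponent // (subsetP sAS) // defA cycle_id.
by rewrite -cycle_eq1 -defA.
Qed.

(** Nontrivial abelian subgroups have order [p], so adjoining any [y] to ['Z(S)] adds nothing. *)
Lemma tame_action_prime : S :!=: 1 -> #|S| = p.
Proof.
move=> ntS; have ntZ: 'Z(S) != 1 by rewrite center_nil_eq1 ?(pgroup_nil pS).
have oZ := tame_action_prime_abelian (center_sub S) (center_abelian S) ntZ.
suffices sSZ: S \subset 'Z(S).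
  by rewrite -oZ; apply: eq_card; apply/subset_eqP; rewrite sSZ center_sub.
apply/subsetP=> y Sy; have sZy := joing_subl 'Z(S) <[y]>.
have oZy: #|'Z(S) <*> <[y]>| = p.
  apply: tame_action_prime_abelian.
  - by rewrite join_subG center_sub cycle_subG.
  - rewrite abelianY center_abelian cycle_abelian.
    by rewrite cycle_subG (subsetP _ y Sy) // centsC subsetIr.
  by apply: contra ntZ => /eqP Zy1; rewrite -subG1 -Zy1.
have /eqP->: 'Z(S) == 'Z(S) <*> <[y]> by rewrite eqEcard sZy oZy oZ leqnn.
by rewrite mem_gen // inE cycle_id orbT.
Qed.

End TameAction.

(** * Vanishing of [p]-singular elements when the [p]-core is trivial *)

Lemma lift_pgroup (p : nat) (gT : finGroupType) (G V : {group gT})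
    (Q : {group coset_of V}) :
    V <| G -> p^'.-group V -> p.-group Q -> Q \subset G / V ->
  exists S : {group gT},
    [/\ S \subset G, p.-group S, S / V = Q, V :&: S = 1 & #|S| = #|Q|].
Proof.
move=> nsVG p'V pQ sQG; have [sVG nVG] := andP nsVG.
have [S sylS] := Sylow_exists p (coset V @*^-1 Q).
have [sSQ pS _] := and3P sylS.
have sSG: S \subset G.
  by rewrite (subset_trans sSQ) // -(quotientGK nsVG) morphpreS.
have nVS := subset_trans sSG nVG.
have tiVS : V :&: S = 1 := coprime_TIg (p'nat_coprime p'V pS).
have defQ: S / V = Q.
  by have:= quotient_pHall nVS sylS; rewrite cosetpreK => /pHall_id->.
by exists S; split; rewrite // -defQ -(card_isog (quotient_isog nVS tiVS)).
Qed.

Lemma vanishing_abelian_pgroup_quotient (p : nat) (gT : finGroupType)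
    (G L V : {group gT}) :
    V <| G -> L <| G -> V \subset L -> abelian V -> p^'.-group V ->
    abelian (L / V) -> p.-group (L / V) -> 'O_p(G) = 1 ->
  {in G, forall x n, x ^+ n \in L -> x ^+ n \notin V -> x \in vanishing G}.
Proof.
move=> nsVG nsLG sVL abV p'V abLV pLV Op1 x Gx n Lxn Vxn.
have [sVG nVG] := andP nsVG; have [sLG nLG] := andP nsLG.
have nsVL : V <| L := normalS sVL sLG nsVG.
have [A [sAG pA defLV tiVA _]] := lift_pgroup nsVG p'V pLV (quotientS V sLG).
have nVA := subset_trans sAG nVG.
have coVA : coprime #|V| #|A| := p'nat_coprime p'V pA.
have defL : V * A = L by rewrite -quotientK // defLV quotientGK.
have abA : abelian A.
  apply/commG1P/trivgP; rewrite -tiVA subsetI commg_subl normG andbT.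
  by rewrite -quotient_cents2 // defLV.
(* ['C_L(V) = V * 'C_A(V)] with commuting factors, so ['C_A(V)] lies in the [p]-core of a normal
   subgroup of [G]. *)
have regA : 'C_A(V) = 1.
  apply/trivgP; rewrite -Op1.
  have sCO: 'C_A(V) \subset 'O_p('C_L(V)).
    apply: pcore_max; first exact: pgroupS (subsetIl _ _) pA.
    have defC: 'C_L(V) = V * 'C_A(V) by rewrite group_modl // defL.
    rewrite /= defC /normal mulG_subr mul_subG ?normG // cents_norm // centsC.
    exact: subsetIr.
  have nsCG: 'C_L(V) <| G by rewrite /normal subIset ?sLG // normsI ?norms_cent.
  apply: subset_trans sCO (pcore_max (pcore_pgroup _ _) _).
  exact: char_normal_trans (pcore_char _ _) nsCG.
have [i regi] := abel_regular_irr nVA abV abA coVA regA.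
have tiIL : 'I['chi_i]%CF :&: L \subset V.
  by rewrite -defL setIC -group_modl ?sub_inertia // regi mulg1.
apply: (vanishing_inertia (t := i) nsVG Gx) => y Gy.
apply: contra Vxn => Ixy; rewrite -(memJ_norm _ (subsetP nVG y Gy)).
apply: (subsetP tiIL); rewrite inE (memJ_norm _ (subsetP nLG y Gy)) Lxn andbT.
by rewrite conjXg groupX.
Qed.

Lemma pcore_quotient_abelian (p r : nat) (gT : finGroupType)
    (G V : {group gT}) :
    prime p -> tame_pvanishing p G -> V <| G -> r.-abelem V -> V :!=: 1 ->
    p^'.-group V -> 'O_p(G) = 1 ->
  abelian 'O_p(G / V).
Proof.
move=> pr_p tameG nsVG abelV ntV p'V Op1.
pose Q := 'O_p(G / V)%G; change (abelian Q).
have [-> | ntQ] := eqVneq (Q : {set _}) 1; first exact: abelian1.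
have nsQG: Q <| G / V := pcore_normal _ _.
have pQ: p.-group Q := pcore_pgroup _ _.
have nVG := normal_norm nsVG; have abV := abelem_abelian abelV.
have ntZ: 'Z(Q) != 1 by rewrite center_nil_eq1 ?(pgroup_nil pQ).
have nsZ: 'Z(Q) <| G / V := char_normal_trans (center_char _) nsQG.
(* A product [s * v], with [s] in a lift of [H], has the same image as [s], so vanishing of elements
   over [H] gives the hypothesis of [tame_action_prime]. *)
have sub_p (H : {group coset_of V}) :
    H \subset Q -> H :!=: 1 ->
    (forall x, x \in G -> coset V x \in H -> coset V x != 1 ->
       x \in vanishing G) ->
  #|H| = p.
  move=> sHQ ntH vanH.
  have sHG := subset_trans sHQ (normal_sub nsQG).
  have [S [sSG pS defH tiVS <-]] := lift_pgroup nsVG p'V (pgroupS sHQ pQ) sHG.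
  have nVS := subset_trans sSG nVG.
  apply: (tame_action_prime pr_p tameG abelV) => //; last first.
    by apply: contra ntH; rewrite -defH => /eqP->; rewrite quotient1.
  move=> s /setD1P[nts Ss] v /setIP[Vv _].
  have coset_sv: coset V (s * v) = coset V s.
    by rewrite mkerr ?ker_coset ?(subsetP nVS).
  have Gs := subsetP sSG s Ss.
  apply: vanH; first by rewrite groupM // (subsetP (normal_sub nsVG)).
    by rewrite coset_sv -defH mem_quotient.
  rewrite coset_sv; apply: contra nts => /eqP/coset_idr Vs.
  by rewrite -in_set1 -[[set 1]]tiVS inE Ss Vs ?(subsetP nVS).
have vanZ x :
  x \in G -> coset V x \in 'Z(Q) -> coset V x != 1 -> x \in vanishing G.
  move=> Gx Zx ntx; have nVx := subsetP nVG x Gx.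
  have [L defZ sVL nsLG] := inv_quotientN nsVG nsZ.
  apply: (@vanishing_abelian_pgroup_quotient p _ G L V _ _ _ _ _ _ _ _ x _ 1%N)
    => //.
  - by rewrite -defZ center_abelian.
  - by rewrite -defZ (pgroupS (center_sub Q)).
  - have nsVL: V <| L := normalS sVL (normal_sub nsLG) nsVG.
    by rewrite -(quotientGK nsVL) mem_morphpre //= -defZ.
  by apply: contra ntx => Vx; rewrite coset_id.
have oZ: #|'Z(Q)| = p by apply: sub_p vanZ => //; apply: center_sub.
have oZ2: #|'Z_2(Q)| = p.
  apply: sub_p; first exact: ucn_sub.
    apply: contra ntZ => /eqP Z1; rewrite -subG1 -Z1.
    by rewrite /= -ucn1 ucn_subS.
  move=> x Gx Z2x ntx; have [/vanZ-> // | notZx] := boolP (coset V x \in 'Z(Q)).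
  have Qx := subsetP (ucn_sub 2 Q) _ Z2x.
  have [y Qy nt_xy]: exists2 y, y \in Q & [~ coset V x, y] != 1.
    apply/exists_inP; apply: contraR notZx; rewrite negb_exists_in.
    move/forall_inP=> cxQ.
    rewrite inE Qx /=; apply/centP=> y Qy; apply/commgP.
    by rewrite -[_ == _]negbK cxQ.
  apply: quotient_vanishing nsVG Gx _.
  apply: (vanishing_center_comm nsQG _ Qx Qy _ nt_xy); first by rewrite oZ.
  by rewrite -ucn1 (subsetP (ucn_comm 1 Q)) ?mem_commg.
(* The upper central series of the nilpotent group [Q] stops at ['Z(Q)], so [Q] is its own
   centre. *)
have eqZ: 'Z_1(Q) = 'Z_2(Q).
  by apply/eqP; rewrite eqEcard ucn_subS ucn1 oZ oZ2 /=.
have: 'Z(Q / 'Z_1(Q)) == 1 by rewrite -ucn_central -eqZ trivg_quotient.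
rewrite center_nil_eq1 ?quotient_nil ?(pgroup_nil pQ) // -subG1.
rewrite quotient_sub1 ?ucn_norm //.
by rewrite /= ucn1 => /subset_trans/(_ (subsetIr _ _)).
Qed.

(** A minimal normal subgroup works: were it a [p]-group, it would lie in ['O_p(G)]. *)
Lemma solvable_pcore1_abelem (p : nat) (gT : finGroupType) (G : {group gT}) :
    solvable G -> G :!=: 1 -> 'O_p(G) = 1 ->
  exists V : {group gT}, exists r : nat,
    [/\ V <| G, r.-abelem V, V :!=: 1 & p^'.-group V].
Proof.
move=> solG ntG Op1; have [V minV sVG] := minnormal_exists ntG (normG G).
have [nVG ntV /is_abelemP[r pr_r abelV]] := minnormal_solvable minV sVG solG.
exists V; exists r; split=> //; first exact/andP.
have rV := abelem_pgroup abelV; apply: (pi_pgroup rV).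
apply: contra ntV; rewrite !inE => /eqP def_r.
by rewrite -subG1 -Op1 pcore_max ?/normal ?sVG // -def_r.
Qed.

Lemma pvanishing_of_pcore1 (p : nat) (gT : finGroupType) (G : {group gT}) :
    prime p -> solvable G -> tame_pvanishing p G -> 'O_p(G) = 1 ->
  {in G, forall x, (p %| #[x])%N -> x \in vanishing G}.
Proof.
move=> pr_p; have [n leGn] := ubnP #|G|.
elim: n gT G leGn => // n IHn gT G leGn solG tameG Op1 x Gx p_x.
have ntG: G :!=: 1.
  apply: contraTneq p_x => G1; move: Gx; rewrite G1 => /set1P->.
  by rewrite order1 dvdn1 neq_ltn prime_gt1 ?orbT.
have [V [r [nsVG abelV ntV p'V]]] := solvable_pcore1_abelem solG ntG Op1.
have [_ nVG] := andP nsVG; have nVx := subsetP nVG x Gx.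
pose Q := 'O_p(G / V)%G; have nsQG: Q <| G / V := pcore_normal _ _.
have [_ nQG] := andP nsQG.
have Gxb: coset V x \in G / V by rewrite mem_quotient.
have nQxb := subsetP nQG _ Gxb.
have [Qy | notQy] := boolP (coset V x.`_p \in Q); last first.
  apply: (quotient_vanishing nsVG Gx); apply: (quotient_vanishing nsQG Gxb).
  apply: IHn; rewrite ?quotient_sol ?trivg_pcore_quotient ?mem_quotient //.
  - rewrite -ltnS (leq_trans _ leGn) // ltnS.
    by rewrite (leq_ltn_trans (leq_quotient _ _)) ?ltn_quotient // normal_sub.
  - by do 2!apply: quotient_tame => //.
  apply: dvdn_order_constt; rewrite -!morph_constt //.
  apply: contra notQy => /eqP/coset_idr->; rewrite // (subsetP nQG) //.
  by rewrite mem_quotient ?groupX.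
have [L defQ sVL nsLG] := inv_quotientN nsVG nsQG.
have abQ: abelian Q.
  exact: pcore_quotient_abelian pr_p tameG nsVG abelV ntV p'V Op1.
(* The [p]-part of [x] is the power of [x] lying in [L] outside [V]. *)
have [k def_y] : exists k, x.`_p = x ^+ k by rewrite /constt; eexists.
have abV := abelem_abelian abelV.
apply: (vanishing_abelian_pgroup_quotient nsVG nsLG sVL abV p'V _ _ Op1 Gx
         (n := k)).
- by rewrite -defQ.
- by rewrite -defQ pcore_pgroup.
- have nsVL: V <| L := normalS sVL (normal_sub nsLG) nsVG.
  by rewrite -def_y -(quotientGK nsVL) mem_morphpre ?groupX //= -defQ.
rewrite -def_y; apply/negP => Vy.
have: x.`_p == 1.
  by rewrite -(constt_p_elt (p_elt_constt p x)) (constt1P (mem_p_elt p'V Vy)).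
by rewrite -order_eq1 order_constt p_part_eq1 mem_primes pr_p order_gt0 p_x.
Qed.

(** * Passage to the quotient by the [p]-core *)

Theorem theoremB (gT : finGroupType) (G P : {group gT}) (p : nat)
    (solG : solvable G) (pr_p : prime p) (sylP : p.-Sylow(G) P)
    (Vo_p1 : size (Vo_at p G) = 1%N) :
  P^`(1) <|<| G /\ cyclic (P / 'O_p(G)).
Proof.
have [sPG pP _] := and3P sylP; have nsOG := pcore_normal p G.
have nOP := subset_trans sPG (normal_norm nsOG).
suffices cycP: cyclic (P / 'O_p(G)).
  split=> //; apply: (@subnormal_trans _ 'O_p(G)); last exact: normal_subnormal.
  apply: nilpotent_subnormal; first exact: pgroup_nil (pcore_pgroup p G).
  by rewrite der1_min // cyclic_abelian.
have [-> | ntP] := eqVneq (P / 'O_p(G)) 1; first exact: cyclic1.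
pose Gb := (G / 'O_p(G))%G; have tameGb : tame_pvanishing p Gb.
  by apply: quotient_tame (Vo_at_tame pr_p Vo_p1).
have solGb: solvable Gb := quotient_sol _ solG.
have Ob1: 'O_p(Gb) = 1 := trivg_pcore_quotient p G.
have sPGb: P / 'O_p(G) \subset Gb := quotientS _ sPG.
have ntGb: Gb :!=: 1.
  by apply: contra ntP => /eqP Gb1; rewrite -subG1 -Gb1.
have [V [r [nsVG abelV ntV p'V]]] := solvable_pcore1_abelem solGb ntGb Ob1.
have pPb: p.-group (P / 'O_p(G)) := quotient_pgroup _ pP.
apply: prime_cyclic.
rewrite (tame_action_prime pr_p tameGb abelV ntV p'V pPb) //.
  exact: subset_trans sPGb (normal_norm nsVG).
(* [s * v] has [p]-part [s], which is nontrivial, so it is [p]-singular and vanishes. *)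
move=> s /setD1P[nts Ps] v /setIP[Vv /cent1P csv].
apply: (pvanishing_of_pcore1 pr_p) => //.
  by rewrite groupM ?(subsetP sPGb _ Ps) ?(subsetP (normal_sub nsVG) _ Vv).
apply: dvdn_order_constt.
by rewrite (constt_mul_p'elt (mem_p_elt pPb Ps) (mem_p_elt p'V Vv) (esym csv)).
Qed.
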